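(* Assume that $\Gamma:\Omega\times[0,T]\rightrightarrows\mathbb R^d$ is an $\mathcal F\otimes\mathcal B([0,T])$-measurable closed convex-valued mapping. Then the set-valued mapping $D(\Gamma):\Omega\rightrightarrows D$, $$D(\Gamma)(\omega)=\{y\in D\mid y_t\in\Gamma_t(\omega)\ \forall t\in[0,T]\},$$ has a measurable graph, i.e. $\{(\omega,y)\in\Omega\times D\mid y\in D(\Gamma)(\omega)\}\in\mathcal F\otimes\mathcal B(D)$.
   Context: $(\Omega,\mathcal F,P)$ is a complete probability space and $T\in(0,+\infty]$. $D$ is the space of $\mathbb R^d$-valued càdlàg functions on $[0,T]$, and $\mathcal B(D)$ is the Borel $\sigma$-algebra of the Skorokhod topology on $D$ (equivalently, the $\sigma$-algebra generated by point evaluations). A set-valued mapping $\Gamma$ is measurable if $\{(\omega,t)\mid\Gamma_t(\omega)\cap O\ne\emptyset\}$ is measurable for every open $O\subseteq\mathbb R^d$. *)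

(* Defs.v *)
From HB Require Import structures.
From mathcomp Require Import all_boot all_order all_algebra.
From mathcomp Require Import all_classical all_reals all_analysis.
Import Order.TTheory GRing.Theory Num.Theory.
Import numFieldNormedType.Exports.

Set Implicit Arguments.
Unset Strict Implicit.
Unset Printing Implicit Defensive.

Local Open Scope classical_set_scope.
Local Open Scope ring_scope.

Notation borel X := (g_sigma_algebraType (@open X)).

Definition setvalued_measurable dX (X : measurableType dX)
    (E : topologicalType) (S : X -> set E) :=
  forall O : set E, open O -> measurable [set x | S x `&` O !=set0].

(* The time interval [0, T] of the extended reals: for T = +oo it contains its
   endpoint, i.e. it is the one-point compactification of the half-line. As a
   set_type it carries the topology and the pseudometric induced by \bar R; the
   latter is |contract s - contract t|, which on [0, T] with T finite is
   uniformly equivalent to |s - t|. *)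
Definition time {R : realType} (T : {posnum \bar R}) : Type :=
  [set t : \bar R | (0 <= t <= T%:num)%E].

Section time.
Context {R : realType} (T : {posnum \bar R}).

Let time0 : time T.
Proof. by exists 0%E; rewrite inE/= lexx ltW. Defined.

HB.instance Definition _ :=
  PseudoMetric.copy (time T) [set t : \bar R | (0 <= t <= T%:num)%E].
HB.instance Definition _ := isPointed.Build (time T) time0.

Definition time_val (t : time T) : \bar R := set_val t.

End time.
Coercion time_val : time >-> constructive_ereal.extended.

(* No side conditions 0 < t, t < T are needed: the filter of right (resp. left)
   neighbourhoods of T (resp. 0) within [0, T] is improper, so that the
   corresponding limit condition is void. *)
Definition cadlag {R : realType} {T : {posnum \bar R}} {d : nat}
    (y : time T -> 'rV[R]_d) :=
  forall t : time T,
    y @ within [set s : time T | (t < s)%E] (nbhs t) --> y t /\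
    exists l : 'rV[R]_d, y @ within [set s : time T | (s < t)%E] (nbhs t) --> l.

Record skorokhod {R : realType} (T : {posnum \bar R}) (d : nat) := Skorokhod {
  skorokhod_fun :> time T -> 'rV[R]_d ;
  skorokhod_cadlag : cadlag skorokhod_fun
}.

(* Such maps are homeomorphisms of [0, T] fixing both endpoints. *)
Definition time_change {R : realType} {T : {posnum \bar R}}
    (l : time T -> time T) :=
  bijective l /\ forall s t : time T, (s < t)%E -> (l s < l t)%E.

(* Skorokhod's J1 topology is given by the distance
     inf_l max(sup_t dist(t, l t), sup_t |x t - y (l t)|),
   where l ranges over the time changes. The sets below are, up to an arbitrarily
   small change of radius, the balls of this distance. *)
Definition skorokhod_ball {R : realType} {T : {posnum \bar R}} {d : nat}
    (x : skorokhod T d) (e : R) (y : skorokhod T d) :=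
  exists2 l : time T -> time T, time_change l &
    forall t, ball t e (l t) /\ ball (x t) e (y (l t)).

Section skorokhod_topology.
Context {R : realType} (T : {posnum \bar R}) (d : nat).
Local Notation D := (skorokhod T d).

Lemma cadlag_cst (c : 'rV[R]_d) : cadlag (fun _ : time T => c).
Proof. by move=> t; split; [exact: cvg_cst|exists c; exact: cvg_cst]. Qed.

HB.instance Definition _ := gen_eqMixin D.
HB.instance Definition _ := gen_choiceMixin D.
HB.instance Definition _ := isPointed.Build D (Skorokhod (cadlag_cst 0)).

Lemma time_change_id : time_change (@id (time T)).
Proof. by split => //; exists id. Qed.

Lemma time_change_comp (l m : time T -> time T) :
  time_change l -> time_change m -> time_change (m \o l).
Proof.
move=> [bl il] [bm im]; split; first exact: bij_comp.
by move=> s t st /=; apply/im/il.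
Qed.

Lemma time_change_inv (l m : time T -> time T) :
  time_change l -> cancel l m -> cancel m l -> time_change m.
Proof.
move=> [_ il] lm ml; split; first by exists l.
move=> s t st; rewrite ltNge; apply/negP; rewrite le_eqVlt => /orP[/eqP ts|].
  have /(congr1 l) : m t = m s by exact/val_inj.
  by rewrite !ml => ts'; rewrite ts' ltxx in st.
by move=> /il; rewrite !ml => /(lt_trans st); rewrite ltxx.
Qed.

Lemma skorokhod_ball_center (x : D) (e : R) : 0 < e -> skorokhod_ball x e x.
Proof.
by move=> e0; exists id => [|t]; [exact: time_change_id|split; exact: ballxx].
Qed.

Lemma skorokhod_ball_sym (x y : D) (e : R) :
  skorokhod_ball x e y -> skorokhod_ball y e x.
Proof.
move=> [l tl xy]; have [[m lm ml] _] := tl.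
exists m; first exact: (time_change_inv tl).
by move=> t; have [b1 b2] := xy (m t); rewrite ml in b1 b2; split; exact: ball_sym.
Qed.

Lemma skorokhod_ball_triangle (x y z : D) (e1 e2 : R) :
  skorokhod_ball x e1 y -> skorokhod_ball y e2 z ->
  skorokhod_ball x (e1 + e2) z.
Proof.
move=> [l tl xy] [m tm yz]; exists (m \o l); first exact: time_change_comp.
move=> t; have [b1 b2] := xy t; have [c1 c2] := yz (l t).
by split; [exact: ball_triangle b1 c1|exact: ball_triangle b2 c2].
Qed.

HB.instance Definition _ :=
  hasNbhs.Build D (nbhs_ (entourage_ (@skorokhod_ball R T d))).
HB.instance Definition _ := Nbhs_isPseudoMetric.Build R D
  erefl skorokhod_ball_center skorokhod_ball_sym skorokhod_ball_triangle erefl.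

End skorokhod_topology.

Definition cadlag_selections {R : realType} {T : {posnum \bar R}} {d : nat}
    {Omega : Type} (Gamma : Omega -> time T -> set 'rV[R]_d) (w : Omega) :
    set (skorokhod T d) :=
  [set y | forall t : time T, Gamma w t (y t)].

(* Main.v *)
Require Import Defs.
From mathcomp Require Import all_boot all_order all_algebra.
From mathcomp Require Import all_classical all_reals all_analysis.
From mathcomp Require Import measurable_realfun lra.
Import Order.TTheory GRing.Theory Num.Theory.
Import numFieldNormedType.Exports.
Local Open Scope classical_set_scope.
Local Open Scope ring_scope.

(** The complement of the graph is a countable union of measurable sets.

If [y t] lies outside the closed set [Gamma w t], then [y t] belongs to a ball
[rball c k] with rational data whose concentric double [rball2 c k] is disjoint
from [Gamma w t]. Put [A = {(w, t) | Gamma w t misses rball2 c k}], which is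
measurable by hypothesis, and let [F] be the closure of [rball c k], which is
contained in [rball2 c k]. By right-continuity [y] stays in [F] on [[t, q)] for
some rational [q > t], unless [t] is the last time [T]. Conversely, a time of
[A w] at which [y] is in [F] refutes that [y] is a selection. It remains to see
that, for fixed [A], [F] and [q],

  [{(w, y) | exists t < q, (w, t) \in A and y \in F on [t, q)}]

is measurable ([measurable_meets_before]). Let [tau y] be the left end of the
longest interval ending at [q] on which [y] is in [F]. Such a [t] exists iff
either [A w] meets [(p, q)] for some rational [p] such that [y] is in [F] on
[(p, q)], or [tau y < q] is itself a time of [A w]. Hence, apart from products
of measurable sets, only two facts are needed.

- On the Skorokhod space, [{y | y \in F on U}] is closed for [U] open and [F]
  closed, because a time change close to the identity keeps a given point of
  [U] inside [U] ([measurable_closed_on_open]). So [tau] is measurable.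
- The set of [w] such that [A w] meets [(p, q)] is the projection of a
  measurable subset of [Omega * time T]. It is measurable because the
  probability is complete ([measurable_projection]).

The projection theorem is reduced to the theorem of Marczewski, that the Suslin
operation preserves measurability for a complete finite measure
([measurable_suslin_operation]). Every time is the supremum of the rationals
selected by a binary sequence, so a measurable subset of [Omega * time T] pulls
back to a subset of [Omega * 2^N]. The subsets of [Omega * 2^N] that are, like
their complements, obtained by a Suslin operation form a sigma-algebra that
makes this coding measurable, and the projection of such a subset to [Omega] is
again the result of a Suslin operation. *)

(** * The Suslin operation preserves measurability *)

Section suslin_operation.
Context {R : realType} {d : measure_display} {Omega : measurableType d}.
Context (mu : {finite_measure set Omega -> \bar R}).

(** An intersection of measurable supersets of [B] whose measures approach the
outer measure of [B]. *)
Lemma measurable_hull (B : set Omega) : exists H : set Omega,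
  [/\ measurable H, B `<=` H &
      forall G, measurable G -> B `<=` G -> mu (H `\` G) = 0%E].
Proof.
pose S := [set mu F | F in [set F | measurable F /\ B `<=` F]].
have S0 : S != set0 by apply/set0P; exists (mu setT), setT.
have [u uS u_inf] := ereal_inf_seq S0.
have /choice[F Fu] :
    forall n, exists F, [/\ measurable F, B `<=` F & mu F = u n].
  by move=> n; have [F [mF BF] Fu] := uS n; exists F.
have mF n : measurable (F n) by case: (Fu n).
have BF n : B `<=` F n by case: (Fu n).
have mH : measurable (\bigcap_n F n) by exact: bigcapT_measurable.
have BH : B `<=` \bigcap_n F n by move=> w Bw n _; exact: BF.
have Hinf : (mu (\bigcap_n F n) <= ereal_inf S)%E.
  rewrite -(cvg_lim _ u_inf)//; apply: lime_ge.
    by apply/cvg_ex; eexists; exact: u_inf.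
  apply: nearW => n; have [_ _ <-] := Fu n.
  by apply: le_measure; rewrite ?inE//; exact: bigcap_inf.
exists (\bigcap_n F n); split => // G mG BG.
have HG : (mu (\bigcap_n F n) <= mu (\bigcap_n F n `&` G))%E.
  apply: (le_trans Hinf); apply: ereal_inf_lbound.
  exists (\bigcap_n F n `&` G) => //; split; first exact: measurableI.
  by move=> w Bw; split; [exact: BH|exact: BG].
rewrite measureD// ?ltey_eq ?fin_num_measure//.
apply/eqP; rewrite eq_le sube_le0 HG/=.
rewrite sube_ge0 ?fin_num_measure//; last exact: measurableI.
by apply: le_measure; rewrite ?inE//; exact: measurableI.
Qed.

(** Instead of sets indexed by finite sequences, a scheme consists of sets
indexed by infinite sequences, the [j]-th of which depends on finitely many
terms only. Schemes can then be merged by any reindexing of the terms, with no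
care for the order in which prefixes grow. *)
Definition suslin_scheme (X : Type) (C : nat -> (nat -> X) -> set Omega) :=
  (forall j f, measurable (C j f)) /\
  forall j, exists m, forall f g,
    (forall i, (i < m)%N -> f i = g i) -> C j f = C j g.

(** Marczewski's argument. Let [A_ s] be the part of the result that comes from
sequences with prefix [s], and [H s] a measurable hull of [A_ s] inside the
sets of the scheme already determined by [s]. As [A_ s] is the union of the
[A_ (rcons s x)], the set [H s] exceeds the union of the [H (rcons s x)] by a
null set only. Outside of these countably many null sets, a point of [H nil]
can be followed along longer and longer prefixes, so it belongs to the
result. *)
Lemma measurable_suslin_operation (X : countType)
    (C : nat -> (nat -> X) -> set Omega) :
  measure_is_complete mu -> suslin_scheme X C ->
  measurable [set w | exists f, forall j, C j f w].
Proof.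
move=> cmu [mC /choice[m Cm]]; set A := [set w | _].
have [->|/set0P[_ [f0 _]]] := eqVneq A set0; first exact: measurable0.
pose x0 := f0 0%N.
pose A_ s := [set w | exists f, mkseq f (size s) = s /\ forall j, C j f w].
pose D s := \bigcap_j
  (if (m j <= size s)%N then C j (nth x0 s) else setT).
have mD s : measurable (D s).
  by apply: bigcapT_measurable => j; case: ifP.
have AD s : A_ s `<=` D s.
  move=> w [f [fs Cf]] j _; case: ifPn => // mjs.
  rewrite (Cm j _ f)// => i im; rewrite -fs nth_mkseq//.
  exact: leq_trans im mjs.
have /choice[H HP] : forall s, exists H : set Omega,
    [/\ measurable H, H `<=` D s, A_ s `<=` H &
      forall G, measurable G -> A_ s `<=` G -> mu (H `\` G) = 0%E].
  move=> s; have [H [mH AH Hmin]] := measurable_hull (A_ s).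
  exists (H `&` D s).
  split; [exact: measurableI|exact: subIsetr|by rewrite subsetI|].
  move=> G mG AG; apply/eqP; rewrite -measure_le0 -(Hmin G mG AG).
  apply: le_measure; rewrite ?inE.
  - by apply: measurableD => //; exact: measurableI.
  - exact: measurableD.
  - by apply: setSD; exact: subIsetl.
have mH s : measurable (H s) by case: (HP s).
have mU s : measurable (\bigcup_x H (rcons s x)).
  exact: countable_bigcupT_measurable.
pose N := \bigcup_s (H s `\` \bigcup_x H (rcons s x)).
have mN : measurable N.
  by apply: countable_bigcupT_measurable => // s; exact: measurableD.
have nN : mu.-negligible N.
  have nH s : mu.-negligible (H s `\` \bigcup_x H (rcons s x)).
    exists (H s `\` \bigcup_x H (rcons s x)).
    split => //; first exact: measurableD.
    have [_ _ _] := HP s; apply => // w [f [fs Cf]].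
    exists (f (size s)) => //.
    have [_ _ + _] := HP (rcons s (f (size s))); apply.
    by exists f; split => //; rewrite size_rcons mkseqS fs.
  pose F n := if @unpickle (seq X) n is Some s
      then H s `\` \bigcup_x H (rcons s x) else set0.
  have -> : N = \bigcup_n F n.
    apply/seteqP; split=> [w [s _ sw]|w [n _]].
      by exists (pickle s) => //; rewrite /F pickleK.
    by rewrite /F; case: unpickle => // s sw; exists s.
  apply: negligible_bigcup => n; rewrite /F.
  by case: unpickle => [s|]; [exact: nH|exact: negligible_set0].
have HNA : H nil `\` N `<=` A.
  move=> w [Hw Nw].
  have step s : exists x, H s w -> H (rcons s x) w.
    have [Hs|Hs] := pselect (H s w); last by exists x0.
    apply: contrapT => /forallNP nx; apply: Nw; exists s => //.
    by split => // -[x _ Hx]; apply: (nx x).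
  have [nxt nxtP] := choice step.
  pose s_ k := iter k (fun s => rcons s (nxt s)) nil.
  have Hs k : H (s_ k) w by elim: k => //= k IH; exact: nxtP.
  have sE k : mkseq (nxt \o s_) k = s_ k.
    by elim: k => // k IH; rewrite mkseqS IH.
  exists (nxt \o s_) => j.
  have [_ /(_ w (Hs (m j))) /(_ j Logic.I) + _ _] := HP (s_ (m j)).
  rewrite -sE size_mkseq leqnn (Cm j _ (nxt \o s_))// => i im.
  by rewrite nth_mkseq.
have -> : A = (H nil `\` N) `|` (A `&` N).
  apply/seteqP; split=> [w Aw|w [/HNA//|[]//]].
  have [Nw|Nw] := pselect (N w); [by right|left; split => //].
  by have [_ _ + _] := HP nil; apply; case: Aw => f fC; exists f.
apply: measurableU; first exact: measurableD.
by apply: cmu; apply: negligibleS nN; exact: subIsetr.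
Qed.

End suslin_operation.

(** * Bi-Suslin subsets of a product with the binary sequences *)

Section bisuslin.
Context {R : realType} {d : measure_display} {Omega : measurableType d}.
Local Notation code := (nat -> bool).

(** The sections of [B] come from Suslin operations whose schemes depend, in the
same finitary way, on the binary sequence. *)
Definition suslin (B : set (Omega * code)) :=
  exists2 C : nat -> (nat -> bool * nat) -> set Omega,
    suslin_scheme (bool * nat)%type C &
    forall w g, B (w, g) <->
      exists f : nat -> nat, forall j, C j (fun i => (g i, f i)) w.

Definition bisuslin := [set B | suslin B /\ suslin (~` B)].

Lemma suslin_cylinder (E : bool -> set Omega) (n : nat) :
  (forall b, measurable (E b)) -> suslin [set p | E (p.2 n) p.1].
Proof.
move=> mE; exists (fun j f => E (f n).1).
  by split => // j; exists n.+1 => f g fg; rewrite fg.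
move=> w g /=; split=> [Eg|[f /(_ 0%N)//]].
by exists (fun=> 0%N).
Qed.

Lemma bisuslin_cylinder (E : bool -> set Omega) (n : nat) :
  (forall b, measurable (E b)) -> bisuslin [set p | E (p.2 n) p.1].
Proof.
move=> mE; split; first exact: suslin_cylinder.
by apply: (suslin_cylinder (fun b => ~` E b)) => b; exact: measurableC.
Qed.

(** The first term of the auxiliary sequence names the set of the union to which
the point belongs, and the other terms witness the membership. *)
Lemma suslin_bigcup (B : nat -> set (Omega * code)) :
  (forall n, suslin (B n)) -> suslin (\bigcup_n B n).
Proof.
move=> /(_ _)/cid2-/all_sig2[C sC BC].
pose sh (f : nat -> bool * nat) (i : nat) := ((f i).1, (f i.+1).2).
exists (fun j f => if unpickle j is Some (n, k)
    then if (f 0%N).2 == n then C n k (sh f) else setT else setT).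
  split=> [j f|j].
    case: unpickle => // -[n k]; case: ifP => // _; exact: (sC n).1.
  case: unpickle => [[n k]|]; last by exists 0%N.
  have [m Cm] := (sC n).2 k.
  exists m.+1 => f g fg; rewrite fg//; case: ifP => // _; apply: Cm => i im.
  by rewrite /sh !fg// ltnW.
move=> w g; split=> [[n _ /BC[f Cf]]|[f Cf]].
  exists (fun i => if i is i'.+1 then f i' else n) => j.
  case: unpickle => // -[n' k]; rewrite [(_, _).2]/=; case: eqP => // <-.
  exact: Cf.
exists (f 0%N) => //; apply/BC; exists (f \o succn) => k.
by have := Cf (pickle (f 0%N, k)); rewrite pickleK/= eqxx.
Qed.

(** One auxiliary sequence carries, along a pairing of the natural numbers, a
witness for each set of the intersection. *)
Lemma suslin_bigcap (B : nat -> set (Omega * code)) :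
  (forall n, suslin (B n)) -> suslin (\bigcap_n B n).
Proof.
move=> /(_ _)/cid2-/all_sig2[C sC BC].
pose ex (n : nat) (f : nat -> bool * nat) (i : nat) :=
  ((f i).1, (f (pickle (n, i))).2).
exists (fun j f =>
    if unpickle j is Some (n, k) then C n k (ex n f) else setT).
  split=> [j f|j].
    case: unpickle => // -[n k]; exact: (sC n).1.
  case: unpickle => [[n k]|]; last by exists 0%N.
  have [m Cm] := (sC n).2 k.
  pose b i := (maxn i (pickle (n, i))).+1.
  exists (\max_(i < m) b i)%N => f g fg.
  apply: Cm => i im.
  have bi : (b i <= \max_(i < m) b i)%N := leq_bigmax (Ordinal im).
  by rewrite /ex !fg//; apply: leq_trans bi; rewrite ltnS ?leq_maxl ?leq_maxr.
move=> w g; split=> [Bw|[f Cf] n _].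
  have /choice[f Cf] : forall n, exists f,
      forall k, C n k (fun i => (g i, f i)) w.
    by move=> n; apply/BC; exact: Bw.
  exists (fun j => if unpickle j is Some (n, i) then f n i else 0%N) => j.
  case: unpickle => // -[n k].
  rewrite (_ : ex _ _ = fun i => (g i, f n i))//.
  by apply/funext => i; rewrite /ex/= pickleK.
apply/BC; exists (fun i => f (pickle (n, i))) => k.
by have := Cf (pickle (n, k)); rewrite pickleK.
Qed.

Lemma sigma_algebra_bisuslin : sigma_algebra setT bisuslin.
Proof.
split=> [|B [sB sCB]|B sB].
- have := bisuslin_cylinder (fun=> set0) 0 (fun=> measurable0).
  by congr bisuslin; apply/seteqP; split.
- by rewrite setTD; split => //; rewrite setCK.
- split; first by apply: suslin_bigcup => n; case: (sB n).
  by rewrite setC_bigcup; apply: suslin_bigcap => n; case: (sB n).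
Qed.

Local Notation coded := (g_sigma_algebraType bisuslin).

Lemma measurable_bisuslinE (B : set coded) : measurable B = bisuslin B.
Proof.
transitivity (<<s bisuslin >> B) => //.
by rewrite sigma_algebra_id//; exact: sigma_algebra_bisuslin.
Qed.

Lemma measurable_coded_fst : measurable_fun [set: coded] (fst : coded -> Omega).
Proof.
move=> _ A mA; rewrite setTI measurable_bisuslinE.
exact: (bisuslin_cylinder (fun=> A) 0).
Qed.

Lemma measurable_coded_digit n :
  measurable_fun [set: coded] ((fun p => p.2 n) : coded -> bool).
Proof.
move=> _ A mA; rewrite setTI measurable_bisuslinE.
apply: (bisuslin_cylinder (fun b => [set _ | A b]) n) => b.
have [Ab|Ab] := pselect (A b).
  by rewrite (_ : [set _ | _] = setT)//; apply/seteqP; split.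
by rewrite (_ : [set _ | _] = set0)//; apply/seteqP; split.
Qed.

(** The binary sequence and the auxiliary sequence are merged into one sequence
of pairs. *)
Lemma measurable_coded_projection (mu : {finite_measure set Omega -> \bar R})
    (B : set coded) :
  measure_is_complete mu -> measurable B ->
  measurable [set w | exists g, B (w, g)].
Proof.
move=> cmu; rewrite measurable_bisuslinE => -[[C sC BC] _].
rewrite (_ : [set w | _] = [set w | exists h, forall j, C j h w]).
  exact: measurable_suslin_operation cmu sC.
apply/seteqP; split=> w /=.
  by move=> [g /BC[f Cf]]; exists (fun i => (g i, f i)).
move=> [h Ch]; exists (fst \o h); apply/BC; exists (snd \o h) => j.
by have := Ch j; congr C; apply/funext => i /=; case: (h i).
Qed.

End bisuslin.

(** * Rationals, Borel sets and suprema in the extended reals *)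

Section ereal.
Context {R : realType}.

(** An enumeration of the rationals. *)
Definition erat (n : nat) : \bar R :=
  (ratr (odflt (0 : rat) (unpickle n)))%:E.

Lemma erat_dense (x y : \bar R) : (x < y)%E ->
  exists n, (x < erat n)%E /\ (erat n < y)%E.
Proof.
have rr (a b : R) : a < b ->
    exists n, (a%:E < erat n)%E /\ (erat n < b%:E)%E.
  move=> /rat_in_itvoo[q]; rewrite in_itv/= => /andP[aq qb]; exists (pickle q).
  by rewrite /erat pickleK !lte_fin.
case: x y => [a| |] [b| |]//; rewrite ?lte_fin.
- exact: rr.
- move=> _; have [|q [aq _]] := rr a (a + 1); first by rewrite ltrDl.
  by exists q; rewrite ltry.
- move=> _; have [|q [_ qb]] := rr (b - 1) b; first by rewrite ltrBlDr ltrDl.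
  by exists q; rewrite ltNyr.
- by move=> _; exists 0%N; rewrite ltry ltNyr.
Qed.

Lemma open_measurable_ereal (O : set (\bar R)) : open O -> measurable O.
Proof.
move=> oO.
have -> : O = (EFin @` (EFin @^-1` O) `|` (O `&` [set +oo%E])) `|`
    (O `&` [set -oo%E]).
  apply/seteqP; split=> [[r| |] Ox|x [[[r Or <-]|[]]|[]]]//.
  - by left; left; exists r.
  - by left; right.
  - by right.
have mO1 (x : \bar R) : measurable (O `&` [set x]).
  have [Ox|Ox] := pselect (O x).
    rewrite (_ : _ `&` _ = [set x]); first exact: emeasurable_set1.
    by apply/seteqP; split=> [y []//|y ->].
  rewrite (_ : _ `&` _ = set0); first exact: measurable0.
  by apply/seteqP; split=> [y [Oy xy]|//]; apply: Ox; rewrite -xy.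
apply: measurableU => //; apply: measurableU => //.
apply: measurable_image_EFin; apply: open_measurable.
by move: oO; rewrite !openE => oO r /= /oO.
Qed.

Context {d} {X : measurableType d}.

Lemma measurable_ereal_sup (h : nat -> X -> \bar R) :
  (forall n, measurable_fun setT (h n)) ->
  measurable_fun setT (fun x => ereal_sup (range (h^~ x))).
Proof.
move=> mh; apply: (measurability _ (ErealGenOInfty.measurableE R)).
move=> _ [_ [r ->] <-]; rewrite setTI.
rewrite (_ : _ @^-1` _ = \bigcup_n (h n @^-1` `]r%:E, +oo[)).
  apply: bigcupT_measurable => n; rewrite -[X in measurable X]setTI.
  by apply: mh => //; exact: emeasurable_itv.
apply/seteqP; split=> x /=; rewrite in_itv/= andbT.
  move=> /ereal_sup_gt[_ [n _ <-] rn].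
  by exists n => //=; rewrite in_itv/= andbT.
move=> [n _ /=]; rewrite in_itv/= andbT => rn; apply: (lt_le_trans rn).
by apply: ereal_sup_ubound; exists n.
Qed.

Lemma measurable_ereal_inf (h : nat -> X -> \bar R) :
  (forall n, measurable_fun setT (h n)) ->
  measurable_fun setT (fun x => ereal_inf (range (h^~ x))).
Proof.
move=> mh; rewrite (_ : (fun x => _) =
    (fun x => - ereal_sup (range (fun n => - h n x)))%E).
  apply: measurableT_comp => //.
  apply: (measurable_ereal_sup (fun n x => - h n x)%E) => n.
  exact: measurableT_comp.
by apply/funext => x; rewrite ereal_infEN image_comp.
Qed.

End ereal.

(** * The time interval *)

Section time.
Context {R : realType} {T : {posnum \bar R}}.

Lemma measurable_fun_time d (X : measurableType d) (h : X -> borel (time T)) :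
  measurable_fun setT (fun x => time_val (h x)) -> measurable_fun setT h.
Proof.
move=> mh; apply: (@measurability _ _ X (borel (time T)) setT h
  (@open (time T)) erefl) => // _ [_ [W oW <-] <-].
rewrite setTI -comp_preimage -[X in measurable X]setTI.
by apply: mh => //; exact: open_measurable_ereal.
Qed.

Lemma time_ge0 (t : time T) : (0 <= t)%E.
Proof. by have /set_mem/andP[] := valP t. Qed.

Lemma time_leT (t : time T) : (t <= T%:num)%E.
Proof. by have /set_mem/andP[] := valP t. Qed.

Lemma time_val_inj : injective (@time_val R T).
Proof. exact: val_inj. Qed.

Lemma clamp_subproof (x : \bar R) :
  maxe 0%E (mine x T%:num) \in [set t : \bar R | (0 <= t <= T%:num)%E].
Proof.
by rewrite inE/= le_max lexx/= ge_max ge_min lexx orbT andbT ltW.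
Qed.

(** A measurable retraction onto the time interval: times are produced below as
suprema and infima of rationals, which are extended reals. *)
Definition clamp (x : \bar R) : time T :=
  exist (fun t => t \in _) _ (clamp_subproof x).

Lemma clampE (x : \bar R) : time_val (clamp x) = maxe 0%E (mine x T%:num).
Proof. by rewrite /time_val set_valE. Qed.

Lemma clamp_time (t : time T) : clamp t = t.
Proof.
by apply: time_val_inj; rewrite clampE min_l ?time_leT// max_r ?time_ge0.
Qed.

Lemma measurable_clamp d (X : measurableType d) (h : X -> \bar R) :
  measurable_fun setT h ->
  measurable_fun setT ((fun x => clamp (h x)) : X -> borel (time T)).
Proof.
move=> mh; apply: measurable_fun_time.
rewrite (_ : (fun x => _) = (fun x => maxe 0%E (mine (h x) T%:num))).
  by apply: measurable_maxe => //; exact: measurable_mine.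
by apply/funext => x; rewrite clampE.
Qed.

Definition end_time : time T := clamp T%:num.

Lemma end_timeE : time_val end_time = T%:num.
Proof. by rewrite clampE minxx max_r// ltW. Qed.

Lemma open_time_lt (x : \bar R) : open [set t : time T | (t < x)%E].
Proof. by exists [set y | (y < x)%E] => //; exact: open_ereal_lt_ereal. Qed.

Lemma open_time_itv (x y : \bar R) :
  open [set t : time T | (x < t)%E /\ (t < y)%E].
Proof.
apply: openI; last exact: open_time_lt.
by exists [set z | (x < z)%E] => //; exact: open_ereal_gt_ereal.
Qed.

Lemma right_nbhs_rat (t : time T) (V : set (time T)) : nbhs t V ->
  (t < T%:num)%E ->
  exists q, [/\ (t < erat q)%E, (erat q <= T%:num)%E &
    forall s : time T, (t <= s)%E -> (s < erat q)%E -> V s].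
Proof.
move=> [_ [[W oW <-] /= Wt WV]] tT.
have : nbhs (time_val t) W by apply: open_nbhs_nbhs; split.
have := time_ge0 t; move: tT; case tE : (time_val t) => [r| |]// rT _;
  last by rewrite ltNge leey in rT.
rewrite /nbhs/= => /nbhs_ballP[e /= e0 We].
have /erat_dense[q []] : (r%:E < mine (r + e)%:E T%:num)%E.
  by rewrite lt_min rT lte_fin ltrDl e0.
rewrite lt_min => rq /andP[qe qT].
exists q; split=> [//| |s]; first exact: ltW.
move=> ts sq; apply: WV => /=.
have := lt_trans sq qe; move: ts; rewrite -/(time_val s).
case: (time_val s) => [u| |]//; rewrite lee_fin lte_fin => ru ue.
apply: We => /=; rewrite /ball/= distrC ger0_norm ?subr_ge0//.
by rewrite ltrBlDl.
Qed.

Definition decode (g : nat -> bool) : \bar R :=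
  ereal_sup (range (fun n => if g n then erat n else -oo%E)).

Lemma decode_surj (t : time T) : exists g, decode g = t.
Proof.
exists (fun n => (erat n <= t)%E).
apply/eqP; rewrite eq_le; apply/andP; split.
  by apply: ge_ereal_sup => _ [n _ <-]; case: ifPn => // _; exact: leNye.
rewrite leNgt; apply/negP => /erat_dense[q [sq qt]].
move: sq; rewrite ltNge => /negP; apply; apply: ereal_sup_ubound.
by exists q => //; rewrite ltW.
Qed.

End time.

(** * The measurable projection theorem *)

Section projection.
Context {R : realType} {d : measure_display} {Omega : measurableType d}.
Context {T : {posnum \bar R}} (mu : {finite_measure set Omega -> \bar R}).

(** Coding times by binary sequences turns the projection along [time T] into a
projection along the binary sequences. *)
Lemma measurable_projection (A : set (Omega * borel (time T))) :
  measure_is_complete mu -> measurable A ->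
  measurable [set w | exists t, A (w, t)].
Proof.
move=> cmu mA.
pose U := g_sigma_algebraType (@bisuslin _ Omega).
pose Psi (p : U) : Omega * borel (time T) := (p.1, clamp (decode p.2)).
have mPsi : measurable_fun setT Psi.
  apply: measurable_fun_pair; first exact: measurable_coded_fst.
  apply: measurable_clamp; apply: measurable_ereal_sup => n.
  apply: measurable_fun_ifT => //; exact: measurable_coded_digit.
have mB : measurable (Psi @^-1` A).
  by rewrite -[X in measurable X]setTI; exact: mPsi.
rewrite (_ : [set w | _] = [set w | exists g, (Psi @^-1` A) (w, g)]).
  exact: measurable_coded_projection cmu mB.
apply/seteqP; split=> w /= [].
  move=> t Awt; have [g gt] := decode_surj t; exists g.
  by rewrite /Psi/= gt clamp_time.
by move=> g Ag; exists (clamp (decode g)).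
Qed.

End projection.

(** * Closed sets of the Skorokhod topology and right-continuity *)

Section skorokhod_sets.
Context {R : realType} {T : {posnum \bar R}} {n : nat}.
Local Notation D := (skorokhod T n).

(** If [y t] is outside [F] for some [t] in [U], then so is [z (l t)] for [z]
close to [y], where [l] is the time change that matches them; the condition on
[U] is that [l t] is still in [U]. So the set is closed. *)
Lemma measurable_closed_on (U : set (time T)) (F : set 'rV[R]_n) :
  (forall t, U t -> exists2 e, 0 < e & forall l : time T -> time T,
     time_change l -> ball t e (l t) -> U (l t)) ->
  closed F -> measurable ([set y | forall t, U t -> F (y t)] : set (borel D)).
Proof.
move=> Ul cF; rewrite -[X in measurable X]setCK; apply: measurableC.
apply: sub_sigma_algebra; rewrite /= openE.
move=> y /existsNP[t] /not_implyP[Ut Fyt].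
have [e e0 eU] := Ul t Ut.
have : nbhs (y t) (~` F).
  by apply: open_nbhs_nbhs; split => //; exact: closed_openC.
move=> /nbhs_ballP[e' /= e'0 e'F].
apply/nbhs_ballP; exists (Num.min e e') => [|z [l tl yz]].
  by rewrite /= lt_min e0.
move=> Fz; have [b1 b2] := yz t.
apply: (e'F (z (l t))).
  by apply: le_ball b2; rewrite ge_min lexx orbT.
apply: Fz; apply: eU => //.
by apply: le_ball b1; rewrite ge_min lexx.
Qed.

Lemma measurable_closed_on_open (U : set (time T)) (F : set 'rV[R]_n) :
  open U -> closed F ->
  measurable ([set y | forall t, U t -> F (y t)] : set (borel D)).
Proof.
move=> oU; apply: measurable_closed_on => t Ut.
have /nbhs_ballP[e /= e0 eU] : nbhs t U by apply: open_nbhs_nbhs; split.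
by exists e => // l _; exact: eU.
Qed.

Lemma time_change_end (l : time T -> time T) :
  time_change l -> l end_time = end_time.
Proof.
move=> [[m lm ml] il]; apply: time_val_inj; apply/eqP; rewrite eq_le.
rewrite [X in (_ <= X)%E]end_timeE time_leT/= leNgt; apply/negP => lT.
have : (m end_time <= (end_time : time T))%E by rewrite end_timeE time_leT.
rewrite le_eqVlt => /orP[/eqP/time_val_inj mT|/il].
  by move: lT; rewrite -{1}mT ml ltxx.
by rewrite ml => /(lt_trans lT); rewrite ltxx.
Qed.

Lemma measurable_closed_at_end (F : set 'rV[R]_n) : closed F ->
  measurable ([set y | F (y end_time)] : set (borel D)).
Proof.
move=> cF.
rewrite (_ : [set y | _] = [set y | forall t, [set end_time] t -> F (y t)]).
  (* time changes fix the end time, so any radius does *)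
  apply: measurable_closed_on => // _ ->; exists 1 => // l tl _.
  exact: time_change_end.
by apply/seteqP; split=> y /= => [Fy t -> //|]; exact.
Qed.

Lemma cadlag_right (y : D) (t : time T) (V : set 'rV[R]_n) :
  nbhs (y t) V -> (t < T%:num)%E -> exists q,
  [/\ (t < erat q)%E, (erat q <= T%:num)%E &
    forall s : time T, (t <= s)%E -> (s < erat q)%E -> V (y s)].
Proof.
move=> Vyt tT; have [/(_ V Vyt) Vy _] := skorokhod_cadlag y t.
have [q [tq qT Vq]] := right_nbhs_rat _ _ Vy tT.
exists q; split => // s; rewrite le_eqVlt => /orP[/eqP/time_val_inj <- _|ts sq].
  exact: nbhs_singleton.
by apply: Vq => //; exact: ltW.
Qed.

(** There are times between [t] and [x], since [t < T]; [y] tends to [y t] along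
them. *)
Lemma closed_left_end (y : D) (t : time T) (x : \bar R) (F : set 'rV[R]_n) :
  closed F -> (t < x)%E -> (t < T%:num)%E ->
  (forall s : time T, (t < s)%E -> (s < x)%E -> F (y s)) -> F (y t).
Proof.
move=> cF tx tT Fs; apply: contrapT => Fyt.
have : nbhs (y t) (~` F).
  by apply: open_nbhs_nbhs; split => //; exact: closed_openC.
move=> /cadlag_right/(_ tT)[q [tq qT Fq]].
have /erat_dense[u []] : (t < mine x (erat q))%E by rewrite lt_min tx tq.
rewrite lt_min => tu /andP[ux uq].
have uE : time_val (clamp (erat u) : time T) = erat u.
  rewrite clampE min_l ?max_r//; first exact: ltW (le_lt_trans (time_ge0 t) tu).
  exact/ltW/(lt_le_trans uq).
by apply: (Fq (clamp (erat u))); rewrite ?uE// ?ltW//; apply: Fs; rewrite uE.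
Qed.

End skorokhod_sets.

(** * Paths that are in a closed set at a time of a measurable random set *)

Section random_times.
Context {R : realType} {d : measure_display} {Omega : measurableType d}.
Context {T : {posnum \bar R}} {n : nat}.
Context (mu : {finite_measure set Omega -> \bar R}).
Context (A : set (Omega * borel (time T))) (F : set 'rV[R]_n).
Hypotheses (cmu : measure_is_complete mu) (mA : measurable A) (cF : closed F).
Local Notation D := (skorokhod T n).

Lemma measurable_meets_end :
  measurable
    [set p : Omega * borel D | A (p.1, end_time) /\ F (p.2 end_time)].
Proof.
apply: measurableI.
  rewrite -[X in measurable X]setTI.
  have mf : measurable_fun setT (fun p : Omega * borel D =>
      (p.1, (end_time : borel (time T)))).
    exact: (measurable_fun_pair measurable_fst (measurable_cst _)).
  exact: mf.
rewrite -[X in measurable X]setTI.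
exact: (measurable_snd measurableT _ (measurable_closed_at_end _ cF)).
Qed.

Variable q : \bar R.
Hypothesis qT : (q <= T%:num)%E.

Let W m : set D :=
  [set y | forall s : time T, (erat m < s)%E /\ (s < q)%E -> F (y s)].

Let mW m : measurable (W m : set (borel D)).
Proof.
apply: (measurable_closed_on_open
  [set s : time T | (erat m < s)%E /\ (s < q)%E]) => //.
exact: open_time_itv.
Qed.

Let tau (y : D) : \bar R :=
  ereal_inf (range (fun m => if `[< W m y >] then erat m else +oo%E)).

Let mtau :
  measurable_fun setT ((fun y => clamp (tau y)) : borel D -> borel (time T)).
Proof.
apply: measurable_clamp; apply: measurable_ereal_inf => m.
apply: measurable_fun_ifT => //; apply: (measurable_fun_bool true).
rewrite setTI (_ : _ @^-1` _ = W m)//.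
by apply/seteqP; split=> y /= => [/asboolP|] Wy; last exact/asboolP.
Qed.

(** Let [t] be such a time. If [y] is in [F] on [(p, q)] for some rational
[p < t], then [w] belongs to the projection of [A] restricted to [(p, q)], a
condition that separates [w] from [y]; otherwise [t] is [tau y]. Conversely,
[y] is in [F] on the times between [clamp (tau y)] and [q]; if
[clamp (tau y) < q], then [q <= T] makes it differ from the last time, so that
by right-continuity [y] is in [F] there too. *)
Lemma measurable_meets_before :
  measurable [set p : Omega * borel D | exists t : time T,
    [/\ A (p.1, t), (t < q)%E &
    forall s : time T, (t <= s)%E -> (s < q)%E -> F (p.2 s)]].
Proof.
pose I m : set Omega :=
  [set w | exists t : time T, [/\ A (w, t), (erat m < t)%E & (t < q)%E]].
have mI m : measurable (I m).
  pose J : set (borel (time T)) :=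
    [set t : time T | (erat m < t)%E /\ (t < q)%E].
  pose B := A `&` (snd @^-1` J).
  rewrite (_ : I m = [set w | exists t, B (w, t)]); last first.
    apply/seteqP.
    by split=> w [t]; [move=> [At mt tq]|move=> [At [mt tq]]]; exists t.
  apply: (measurable_projection mu) => //; apply: measurableI => //.
  rewrite -[X in measurable X]setTI; apply: measurable_snd => //.
  apply: sub_sigma_algebra.
  exact: open_time_itv.
pose Q : set (borel (time T)) := [set t : time T | (t < q)%E].
pose Phi (p : Omega * borel D) : Omega * borel (time T) :=
  (p.1, clamp (tau p.2)).
have mPhi : measurable_fun setT Phi.
  by apply: measurable_fun_pair => //; exact: (measurableT_comp mtau).
rewrite (_ : [set p | _] = \bigcup_m (I m `*` W m) `|`
    (Phi @^-1` (A `&` (snd @^-1` Q)))).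
  apply: measurableU.
    by apply: bigcupT_measurable => m; apply: measurableX => //; exact: mW.
  rewrite -[X in measurable X]setTI; apply: mPhi => //; apply: measurableI => //.
  rewrite -[X in measurable X]setTI; apply: measurable_snd => //.
  by apply: sub_sigma_algebra; exact: open_time_lt.
apply/seteqP; split=> -[w y] /=.
  move=> [t [At tq Fy]].
  have Wt m : (t <= erat m)%E -> W m y.
    by move=> tm s [ms sq]; apply: Fy => //; apply: le_trans (ltW ms).
  have [[m [Wm mt]]|noW] := pselect (exists m, W m y /\ (erat m < t)%E).
    by left; exists m => //; split => //; exists t; split.
  right; rewrite /Phi/=; have -> : clamp (tau y) = t.
    rewrite -[RHS]clamp_time; congr clamp.
    apply/eqP; rewrite eq_le; apply/andP; split.
      rewrite leNgt; apply/negP => /erat_dense[m [tm]].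
      rewrite ltNge => /negP; apply; apply: ereal_inf_lbound.
      by exists m => //; case: asboolP => // nW; exfalso; apply/nW/Wt/ltW.
    apply: le_ereal_inf_tmp => _ [m _ <-].
    case: asboolP => [Wm|_]; last exact: leey.
    by rewrite leNgt; apply/negP => mt; apply: noW; exists m.
  by split.
move=> [[m _ [[t [At mt tq]] Wm]]|[At tq]].
  exists t; split => // s ts sq; apply: Wm; split => //.
  exact: lt_le_trans ts.
exists (clamp (tau y)); split => // s.
have Fr (s' : time T) :
    ((clamp (tau y) : time T) < s')%E -> (s' < q)%E -> F (y s').
  move=> ts s'q.
  have : (tau y < s')%E.
    move: ts; rewrite clampE gt_max gt_min => /andP[_ /orP[//|]].
    by rewrite ltNge time_leT.
  move=> /ereal_inf_lt[_ [m _ <-]].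
  case: asboolP => [Wm ms|_]; last by rewrite ltNge leey.
  by apply: Wm; split.
rewrite le_eqVlt => /orP[/eqP/time_val_inj <- _|]; last exact: Fr.
apply: (closed_left_end _ _ q) => //.
exact: lt_le_trans qT.
Qed.

End random_times.

(** * Measurability of the graph *)

Section rational_balls.
Context {R : realType} {n : nat}.

Definition rball (c : 'rV[rat]_n) (k : nat) : set 'rV[R]_n :=
  ball (map_mx ratr c : 'rV[R]_n) k.+1%:R^-1.

Definition rball2 (c : 'rV[rat]_n) (k : nat) : set 'rV[R]_n :=
  ball (map_mx ratr c : 'rV[R]_n) (k.+1%:R^-1 + k.+1%:R^-1).

Lemma closure_rball c k : closure (rball c k) `<=` rball2 c k.
Proof.
move=> v cv; have k0 : 0 < k.+1%:R^-1 :> R by rewrite invr_gt0.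
have [u [cu /ball_sym vu]] := cv _ (nbhsx_ballx v _ k0).
exact: ball_triangle cu vu.
Qed.

Lemma rball_basis (v : 'rV[R]_n) (V : set 'rV[R]_n) : nbhs v V ->
  exists c k, rball c k v /\ rball2 c k `<=` V.
Proof.
move=> /nbhs_ballP[e /= e0 eV].
(* the doubled ball lies in the ball about v of three times the radius *)
have [k ke] : exists k, k.+1%:R^-1 < e / 3 :> R.
  have e3 : 0 < e / 3 by rewrite divr_gt0.
  exists (Num.bound (e / 3)^-1).
  rewrite -[ltRHS]invrK ltf_pV2 ?posrE ?invr_gt0//.
  apply: (lt_trans (archi_boundP _)); first by rewrite invr_ge0 ltW.
  by rewrite ltr_nat.
have k0 : 0 < k.+1%:R^-1 :> R by rewrite invr_gt0.
have /choice[c cv] :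
    forall j, exists q : rat, ball (ratr q : R) k.+1%:R^-1 (v ord0 j).
  move=> j.
  have /rat_in_itvoo[q] : v ord0 j - k.+1%:R^-1 < v ord0 j.
    by rewrite ltrBlDr ltrDl.
  rewrite in_itv/= => /andP[vq qv]; exists q.
  by rewrite /ball/= distrC ger0_norm ?subr_ge0 1?ltW// ltrBlDr addrC -ltrBlDr.
have bcv : rball (\row_j c j) k v.
  by split => // i j; rewrite !mxE (ord1 i); exact: cv.
exists (\row_j c j), k; split => // u cu; apply: eV.
have := ball_triangle (ball_sym bcv) cu; apply: le_ball.
by move: ke; set r := k.+1%:R^-1; lra.
Qed.

End rational_balls.

Theorem theorem7 (R : realType) (dO : measure_display)
    (Omega : measurableType dO) (P : probability Omega R)
    (P_complete : measure_is_complete P)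
    (T : {posnum \bar R}) (d : nat)
    (Gamma : Omega -> time T -> set 'rV[R]_d)
    (Gamma_measurable : setvalued_measurable
      (fun p : Omega * borel (time T) => Gamma p.1 p.2))
    (Gamma_closed : forall w t, closed (Gamma w t))
    (Gamma_convex : forall w t, convex_set (Gamma w t)) :
  measurable [set p : Omega * borel (skorokhod T d) |
    cadlag_selections Gamma p.1 p.2].
Proof.
pose A c k := [set p : Omega * borel (time T) |
  ~ (Gamma p.1 p.2 `&` rball2 c k !=set0)].
have mA c k : measurable (A c k).
  by apply: measurableC; apply: Gamma_measurable; exact: ball_open.
pose F c k : set 'rV[R]_d := closure (rball c k).
have cF c k : closed (F c k) by exact: closed_closure.
have AFN c k w t v : A c k (w, t) -> F c k v -> ~ Gamma w t v.
  by move=> /= nGt Fv Gv; apply: nGt; exists v; split => //; exact: closure_rball.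
pose E c k := [set p : Omega * borel (skorokhod T d) |
  A c k (p.1, end_time) /\ F c k (p.2 end_time)].
pose B c k m := [set p : Omega * borel (skorokhod T d) | exists t : time T,
    [/\ A c k (p.1, t), (t < erat m)%E &
    forall s : time T, (t <= s)%E -> (s < erat m)%E -> F c k (p.2 s)]].
rewrite -[X in measurable X]setCK; apply: measurableC.
rewrite (_ : ~` _ = \bigcup_c \bigcup_k (E c k `|`
    \bigcup_(m in [set m | (erat m <= T%:num)%E]) B c k m)).
  apply: countable_bigcupT_measurable => // c; apply: bigcupT_measurable => k.
  apply: measurableU; first exact: measurable_meets_end.
  apply: bigcup_measurable => m /= mT; exact: (measurable_meets_before P).
apply/seteqP; split=> -[w y] /=; last first.
  move=> [c _ [k _ [[At Fy]|[m _ [t [At tm Fy]]]]]] sel.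
    exact: (AFN _ _ _ _ _ At Fy (sel _)).
  exact: (AFN _ _ _ _ _ At (Fy t (lexx _) tm) (sel _)).
move=> /existsNP[t nGt].
have : nbhs (y t) (~` Gamma w t).
  by apply: open_nbhs_nbhs; split => //; exact: closed_openC.
move=> /rball_basis[c [k [cy cG]]].
have At : A c k (w, t) by move=> [v [Gv /cG]].
exists c => //; exists k => //.
have := time_leT t; rewrite le_eqVlt => /orP[/eqP tT|tT].
  left; rewrite /E/=.
  have -> : end_time = t by apply: time_val_inj; rewrite end_timeE.
  by split => //; exact: subset_closure.
right; have : nbhs (y t) (rball c k).
  by apply: open_nbhs_nbhs; split => //; exact: ball_open.
move=> /cadlag_right/(_ tT)[m [tm mT Vm]].
exists m => //; exists t; split => // s ts sm.
by apply: subset_closure; exact: Vm.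
Qed.
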